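(* Let $F$ be an algebraically closed field and $n\ge 1$. The subset $\pi(U)$ of $\mathcal{N}_2$, consisting of those pairs $(A,B)\in\mathcal{N}_2$ that generate a Gorenstein algebra $\mathcal{A}(A,B)$ of vector space dimension $n$ over $F$, is dense in $\mathcal{N}_2$.
   Context: $\mathcal{N}_2\subset M_n(F)\times M_n(F)$ is the variety of all pairs of commuting nilpotent $n\times n$ matrices over $F$, with the Zariski topology. For $(A,B)\in\mathcal{N}_2$, $\mathcal{A}(A,B)$ denotes the unital subalgebra of $M_n(F)$ generated by $A$ and $B$; it is a commutative local artinian algebra. A commutative local artinian $F$-algebra $\mathcal{A}$ arising in this way, with maximal ideal $m$, is Gorenstein if its socle $\mathrm{Soc}(\mathcal{A})=(0:m)$ (the annihilator of $m$ in $\mathcal{A}$) is one-dimensional over $F$. A vector $v\in F^n$ is cyclic for a commuting pair $(A,B)$ if the vectors $A^iB^jv$, $i,j\ge 0$, span $F^n$. The set $U\subset\mathcal{N}_2\times F^n\times F^n$ is the set of all quadruples $(A,B,v,w)$ such that $v$ is a cyclic vector for $(A,B)$ and $w$ is a cyclic vector for the pair of transposes $(A^T,B^T)$. The map $\pi:\mathcal{N}_2\times F^n\times F^n\to\mathcal{N}_2$ is the projection to the first factor, so $\pi(U)$ is the set of $(A,B)\in\mathcal{N}_2$ for which both $(A,B)$ and $(A^T,B^T)$ have a cyclic vector. *)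

(* Defs.v *)
From HB Require Import structures.
From mathcomp Require Import all_boot all_order all_algebra all_field.
From mathcomp Require Import mpoly.

Set Implicit Arguments.
Unset Strict Implicit.
Unset Printing Implicit Defensive.

Import GRing.Theory.
Local Open Scope ring_scope.

Section GorensteinAlgebras.
Variables (F : fieldType) (aT : falgType F).
Implicit Types (A : {aspace aT}) (I J m : {vspace aT}).

(* Ideals are only considered in commutative subalgebras, so that left ideals
   and annihilators are two-sided.  Since A is unital, an ideal of A is
   automatically a subspace. *)
Definition is_ideal A I : Prop := (I <= A)%VS /\ (A * I <= I)%VS.

Definition is_maximal_ideal A m : Prop :=
  [/\ is_ideal A m, m != A :> {vspace aT} &
      forall J, is_ideal A J -> (m <= J)%VS -> J = m \/ J = A :> {vspace aT}].

Definition is_local_with A m : Prop :=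
  is_maximal_ideal A m /\ forall m', is_maximal_ideal A m' -> m' = m.

(* The annihilator (0 : m) = {x in A | x * y = 0 for all y in m}, see
   annihilatorP; it is enough to test the vectors y of a basis of m. *)
Definition annihilator A m : {vspace aT} :=
  (A :&: \bigcap_(i < \dim m) lker (amulr (vbasis m)`_i))%VS.

Lemma annihilatorP A m x :
  reflect (x \in A /\ forall y, y \in m -> x * y = 0) (x \in annihilator A m).
Proof.
rewrite /annihilator memv_cap [X in _ && X]memvE.
apply: (iffP andP) => -[xA h]; split=> //.
  move=> y ym; rewrite (coord_vbasis ym) mulr_sumr big1 // => i _.
  move/subv_bigcapP/(_ i isT): h; rewrite -memvE memv_ker lfunE /= => /eqP h.
  by rewrite -scalerAr h scaler0.
apply/subv_bigcapP => i _; rewrite -memvE memv_ker lfunE /=.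
by rewrite h // vbasis_mem // mem_nth // size_tuple.
Qed.

Definition is_gorenstein A : Prop :=
  exists2 m, is_local_with A m & \dim (annihilator A m) = 1%N.

End GorensteinAlgebras.

Section CommutingNilpotentPairs.
Variables (F : fieldType) (n : nat).

Definition mxpair := ('M[F]_n.+1 * 'M[F]_n.+1)%type.
Implicit Types (P : mxpair) (S Y Z : mxpair -> Prop).

Definition mxnilpotent (A : 'M[F]_n.+1) : Prop := exists k, A ^+ k = 0.

Definition N2 P : Prop :=
  [/\ mxnilpotent P.1, mxnilpotent P.2 & P.1 *m P.2 = P.2 *m P.1].

Definition generated_algebra P : {aspace 'M[F]_n.+1} :=
  <<1 & [:: P.1; P.2]>>%AS.

Definition trmx_pair P : mxpair := (P.1^T, P.2^T).

Definition cyclic_vector P (v : 'cV[F]_n.+1) : Prop :=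
  forall u : 'cV[F]_n.+1, exists (N : nat) (c : nat -> nat -> F),
    u = \sum_(i < N) \sum_(j < N) c i j *: (P.1 ^+ i *m P.2 ^+ j *m v).

Definition quadU (q : mxpair * 'cV[F]_n.+1 * 'cV[F]_n.+1) : Prop :=
  let: (P, v, w) := q in
  [/\ N2 P, cyclic_vector P v & cyclic_vector (trmx_pair P) w].

Definition proj_N2 (q : mxpair * 'cV[F]_n.+1 * 'cV[F]_n.+1) : mxpair := q.1.1.

Definition piU P : Prop := exists2 q, quadU q & proj_N2 q = P.

(* M_n(F) x M_n(F) is identified with affine space of dimension 2 n^2 by
   listing the entries of both matrices. *)
Definition mxpair_coord P (i : 'I_(n.+1 * n.+1 + n.+1 * n.+1)) : F :=
  row_mx (mxvec P.1) (mxvec P.2) 0 i.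

Definition zariski_closed Z : Prop :=
  exists T : {mpoly F[n.+1 * n.+1 + n.+1 * n.+1]} -> Prop,
    forall P, Z P <-> (forall p, T p -> p.@[mxpair_coord P] = 0).

Definition zariski_closure S P : Prop :=
  forall Z, zariski_closed Z -> (forall Q, S Q -> Z Q) -> Z P.

(* The closure of S in the subspace Y is the intersection of Y with the
   closure of S in M_n(F) x M_n(F). *)
Definition zariski_dense_in Y S : Prop :=
  (forall P, S P -> Y P) /\ (forall P, Y P -> zariski_closure S P).

End CommutingNilpotentPairs.

(* Main.v *)
Require Import Defs.
From HB Require Import structures.
From mathcomp Require Import all_boot all_order all_algebra all_field.
From mathcomp Require Import mpoly.

Set Implicit Arguments.
Unset Strict Implicit.
Unset Printing Implicit Defensive.

Import GRing.Theory.
Local Open Scope ring_scope.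

(** _The Gorenstein description._  Let [alg] be the algebra generated by a
    commuting nilpotent pair [(A, B)].  It is local, with maximal ideal [aug]
    generated by [A] and [B], and every nonzero ideal meets its socle.  If [v]
    is cyclic then [a |-> a v] identifies [alg] with the whole space; if moreover
    [w] is cyclic for the transposes then [a |-> w^T a v] is injective on the
    socle, which is therefore a line.  Conversely let [z] span the socle of a
    Gorenstein [alg] of dimension equal to the size of the matrices.  Every
    nonzero [a] has a multiple equal to [z], so [z v <> 0] makes [a |-> a v]
    injective, hence bijective, and [v] is cyclic; likewise any [w] with
    [w^T z <> 0] is cyclic for the transposes ([piU_iff]).

    _Density._  The irreducibility of the variety of commuting nilpotent pairs
    is bypassed: it is enough to fix a nilpotent [A] and to move [B] along lines
    inside the nilpotent commutator of [A] ([cyclic_mod_dense]).  Work with row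
    vectors, so that [A], as a row space, is the image of [A].  A flag
    of [B]-stable subspaces containing the image of [A] is climbed by one
    dimension at a time; each step adds to [B] a multiple of a matrix [X] that
    commutes with [A] and, modulo the image of [A], has rank at most one and
    links the new basis vector of the flag to the preceding one.  The flag is
    chosen compatible with the filtration by the kernels of the powers of [A],
    which is what makes such an [X] exist ([commuting_rank_one_mod]).
    Triangularity with respect to the flag keeps [B + s X] nilpotent, and at the
    top of the flag a single vector generates the space modulo the images of [A]
    and [B], so it is cyclic by nilpotency.

    Consequently a property of [B] that is inherited by [B] from a punctured line
    through [B], and that holds whenever there is a cyclic row vector, holds on
    the whole nilpotent commutator of [A].  The vanishing of a polynomial is such
    a property.  Having a cyclic vector is an open condition on [B], expressed by
    a minor; applying the principle first to [A], then to [A^T] and the product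
    of the given polynomial with this minor, gives pairs with both cyclic vectors
    ([vanish_on_N2]). *)

(** * Matrices commuting with a nilpotent matrix *)

Lemma commXX (R : pzRingType) (a b : R) k l :
  a * b = b * a -> a ^+ k * b ^+ l = b ^+ l * a ^+ k.
Proof. by move=> cab; apply/commrX/commr_sym/commrX. Qed.

Section Deformation.
Variables (F : fieldType) (n : nat).
Implicit Types (A B X S : 'M[F]_n.+1) (v f : 'rV[F]_n.+1).

Lemma mulmx_exprSr A k : A ^+ k *m A = A ^+ k.+1.
Proof. by rewrite exprSr. Qed.

Lemma mulmx_exprS A k : A *m A ^+ k = A ^+ k.+1.
Proof. by rewrite exprS. Qed.

(** Since [B] commutes with [A], each factor [B ^+ N] contributes one power of
    [A]. *)
Lemma nilpotent_mod A B N : mxnilpotent A -> A *m B = B *m A ->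
  (B ^+ N <= A)%MS -> mxnilpotent B.
Proof.
move=> [k Ak0] cAB /submxP[D defBN]; exists (N * k)%N.
suff [E ->]: exists E, B ^+ (N * k) = E * A ^+ k by rewrite Ak0 mulr0.
elim: k {Ak0} => [|k [E defE]]; first by exists 1; rewrite muln0 mul1r.
exists (E * D); rewrite mulnS addnC exprD {1}defE -mulrA.
by rewrite (@commXX _ A B) // defBN -mulrA mulmxE -mulrA -exprS.
Qed.

Lemma submx_stableX m (W : 'M[F]_(m, n.+1)) B j :
  (W *m B <= W)%MS -> (W *m B ^+ j <= W)%MS.
Proof.
move=> WB; elim: j => [|j IH]; first by rewrite expr0 mulmx1.
by rewrite exprSr -mulmxE mulmxA (submx_trans (submxMr _ IH)).
Qed.

(** The perturbation [X] is invisible on [W] modulo [S], so [B + X] and [B]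
    have the same powers there. *)
Lemma submx_exp_perturb m S B X (W : 'M[F]_(m, n.+1)) j :
    (S *m B <= S)%MS -> (S *m X <= S)%MS -> (W *m B <= W)%MS ->
    (W *m X <= S)%MS ->
  (W *m (B + X) ^+ j <= S + W *m B ^+ j)%MS.
Proof.
move=> SB SX WB WX; elim: j => [|j IH]; first by rewrite expr0 addsmxSr.
rewrite exprSr -mulmxE mulmxA; apply: submx_trans (submxMr _ IH) _.
rewrite addsmxMr addsmx_sub; apply/andP; split.
  by apply/(submx_trans _ (addsmxSl _ _)); rewrite mulmxDr addmx_sub.
rewrite mulmxDr addmx_sub //.
  by rewrite exprSr -mulmxE mulmxA addsmxSr.
apply: submx_trans (addsmxSl _ _); apply: submx_trans (submxMr _ _) WX.
exact: submx_stableX.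
Qed.

Lemma separating_functional S f : ~~ (f <= S)%MS ->
  exists phi : 'cV[F]_n.+1, S *m phi = 0 /\ f *m phi = 1%:M.
Proof.
rewrite submxE; move: (mulmx_coker S); move: (cokermx S) => C SC.
move=> /matrix0Pn[i [j nz]]; exists (((f *m C) i j)^-1 *: col j C).
rewrite -!scalemxAr !colE !mulmxA SC mul0mx scaler0; split=> //.
rewrite -colE; apply/matrixP=> k l.
by rewrite mxE [X in _ * X]mxE [RHS]mxE !ord1 eqxx -(ord1 i) mulVf.
Qed.

(** A functional that vanishes on the kernel of [A] descends to the image of
    [A] and extends from there to the whole space. *)
Lemma functional_factor (A : 'M[F]_n.+1) (phi : 'cV[F]_n.+1) :
  kermx A *m phi = 0 -> exists psi, phi = A *m psi.
Proof.
move=> kphi; suff /submxP[D defphi]: (phi^T <= A^T)%MS.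
  by exists D^T; apply: trmx_inj; rewrite trmx_mul trmxK.
have /submxP[D defC]: ((cokermx A^T)^T <= kermx A)%MS.
  by apply/sub_kermxP/trmx_inj; rewrite trmx_mul trmxK mulmx_coker trmx0.
rewrite submxE; apply/eqP/trmx_inj.
by rewrite trmx_mul trmxK defC -mulmxA kphi mulmx0 trmx0.
Qed.

(** As [v] is killed by [A ^+ q.+1] while [phi] kills the image of [A] and
    factors through [A ^+ q], the rank one matrix [phi *m v] can be corrected,
    modulo the image of [A], into a matrix commuting with [A].  In terms of [F[t]]-modules, [X] is the composite
    of a map to [F[t]/(t^(q+1))], which exists because this ring is
    self-injective, with the map sending [1] to [v]. *)
Lemma commuting_rank_one_mod A (phi : 'cV[F]_n.+1) v q :
    A *m phi = 0 -> kermx (A ^+ q) *m phi = 0 -> v *m A ^+ q.+1 = 0 ->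
  exists X Y, A *m X = X *m A /\ X = phi *m v + Y *m A.
Proof.
move=> Aphi /functional_factor[psi defphi] vA.
pose T i := A ^+ (q - i) *m psi *m v *m A ^+ i.
exists (\sum_(i < q.+1) T i).
exists (\sum_(i < q) A ^+ (q - i.+1) *m psi *m v *m A ^+ i).
split; last first.
  rewrite big_ord_recl /T subn0 expr0 mulmx1 -defphi mulmx_suml; congr (_ + _).
  by apply: eq_bigr => i _; rewrite -[in RHS]mulmxA lift0 exprSr.
(* Multiplying by A on either side shifts the sum; the two boundary terms
   vanish by the hypotheses on phi and v. *)
rewrite mulmx_sumr mulmx_suml big_ord_recl big_ord_recr /= /T subn0 expr0 mulmx1.
rewrite -defphi mulmxA Aphi mul0mx add0r -[X in _ + X]mulmxA.
rewrite mulmx_exprSr -[X in _ + X]mulmxA vA mulmx0 addr0.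
apply: eq_bigr => i _; rewrite /bump leq0n add1n !mulmxA mulmx_exprS.
by rewrite -subSn // subSS -[RHS]mulmxA mulmx_exprSr.
Qed.

(** The next vector of the flag: it is taken in the first kernel of a power of
    [A] not contained in [S], and is pushed by [B] as far as possible outside
    [S]. *)
Lemma next_generator A B S :
    mxnilpotent A -> mxnilpotent B -> A *m B = B *m A -> (S *m B <= S)%MS ->
    ~~ row_full S ->
  exists q f, [/\ ~~ (f <= S)%MS, (f *m B <= S)%MS, f *m A ^+ q.+1 = 0
               & (kermx (A ^+ q) <= S)%MS].
Proof.
move=> [a Aa0] [b Bb0] cAB SB nfull.
have exq : exists q, ~~ (kermx (A ^+ q) <= S)%MS.
  exists a; apply: contra nfull => kS; rewrite -sub1mx.
  by apply: submx_trans kS; apply/sub_kermxP; rewrite Aa0 mulmx0.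
case: (ex_minnP exq) => [[|q]] nk minq.
  by case/negP: nk; rewrite expr0 -[kermx _]mulmx1 mulmx_ker sub0mx.
pose K := kermx (A ^+ q.+1).
have exk : exists k, (K *m B ^+ k <= S)%MS.
  by exists b; rewrite Bb0 mulmx0 sub0mx.
case: (ex_minnP exk) => [[|k]] Kk mink.
  by case/negP: nk; rewrite expr0 mulmx1 in Kk.
have /row_subPn[i nfS]: ~~ (K *m B ^+ k <= S)%MS.
  by apply/negP => /mink; rewrite ltnn.
exists q, (row i (K *m B ^+ k)); split=> //.
- rewrite -row_mul -mulmxA; apply: submx_trans (row_sub _ _) _.
  by rewrite mulmx_exprSr.
- rewrite -row_mul -mulmxA [B ^+ k *m _](@commXX _ B A) //.
  by rewrite -mulmxE mulmxA mulmx_ker mul0mx row0.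
by apply/negPn/negP => /minq; rewrite ltnn.
Qed.

(** * Deforming to a cyclic vector along lines *)

(** The state of the climb along the flag: [S] contains the image of [A] and
    [v] generates [S] modulo this image under [B].  The generation is stated as
    in Nakayama's lemma, so that it survives a perturbation of [B] without
    naming powers of [B].  The last two conditions say that [v] lies at level
    [q] of the filtration by the kernels of the powers of [A] and that all lower
    levels have been exhausted; [v = 0], [q = 0] starts the climb at the image
    of [A]. *)
Definition cyclic_layer A B S v q :=
  [/\ (A <= S)%MS, (S *m B <= S)%MS, (v <= S)%MS & (S <= A + v + S *m B)%MS]
  /\ v *m A ^+ q.+1 = 0 /\ (kermx (A ^+ q) <= S)%MS.

(** Let [f] be the next vector of the flag and let [X] send [f] to [v] and [S]
    to 0 modulo the image of [A].  Then [f (B + s X)] is [(c + s) v] plus a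
    vector of [S B], where [c] is the coefficient of [v] in [f B], so for
    [s <> - c] it is again a generator of [S], and [f] generates [S + f].  As
    [X] maps everything into [S] and [S] into the image of [A], nilpotency is
    not affected. *)
Lemma layer_step A B S v q :
    mxnilpotent A -> mxnilpotent B -> A *m B = B *m A ->
    cyclic_layer A B S v q -> ~~ row_full S ->
  exists X S' v' q' s0, [/\ \rank S < \rank S',
    forall s, A *m (B + s *: X) = (B + s *: X) *m A /\ mxnilpotent (B + s *: X)
    & forall s, s != s0 -> cyclic_layer A (B + s *: X) S' v' q']%N.
Proof.
move=> nilA nilB cAB [[AS SB vS Sgen] [vA kS]] nfull.
have [q' [f [nfS fBS fA kS']]] := next_generator nilA nilB cAB SB nfull.
have [phi [Sphi fphi]] := separating_functional nfS.
have Aphi : A *m phi = 0.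
  by case/submxP: AS => D ->; rewrite -mulmxA Sphi mulmx0.
have kphi : kermx (A ^+ q) *m phi = 0.
  by case/submxP: kS => D ->; rewrite -mulmxA Sphi mulmx0.
have [X [Y [cAX defX]]] := commuting_rank_one_mod Aphi kphi vA.
have SX : (S *m X <= A)%MS.
  by rewrite defX mulmxDr !mulmxA Sphi mul0mx add0r submxMl.
have XS : (X <= S)%MS.
  by rewrite defX addmx_sub ?(submx_trans (submxMl _ _)).
have [c [t [deffB tle]]] :
    exists c t, f *m B = c *: v + t /\ (t <= A + S *m B)%MS.
  have /sub_addsmxP[[u w] /= ->]: (f *m B <= A + S *m B + v)%MS.
    apply: submx_trans fBS (submx_trans Sgen _).
    by rewrite -!addsmxA addsmxS // addsmxC.
  exists (w 0 0), (u *m (A + S *m B)%MS); rewrite submxMl addrC; split=> //.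
  by rewrite {1}[w]mx11_scalar mul_scalar_mx.
exists X, (S + f)%MS, f, q', (- c); split.
- have /leqifP := mxrank_leqif_sup (addsmxSl S f).
  by rewrite addsmx_sub (negPf nfS) andbF.
- move=> s; have cABs : A *m (B + s *: X) = (B + s *: X) *m A.
    by rewrite mulmxDr mulmxDl cAB -scalemxAr -scalemxAl cAX.
  split=> //; have [b Bb0] := nilB.
  have SsX : (S *m (s *: X) <= A)%MS by rewrite -scalemxAr scalemx_sub.
  have one : ((B + s *: X) ^+ b <= S)%MS.
    have := @submx_exp_perturb n.+1 S B (s *: X) 1%:M b SB (submx_trans SsX AS).
    rewrite !mul1mx Bb0 addsmx0; apply; first exact: submx1.
    exact: scalemx_sub.
  have two : (S *m (B + s *: X) ^+ b <= A)%MS.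
    have := @submx_exp_perturb n.+1 A B (s *: X) S b.
    rewrite Bb0 mulmx0 addsmx0; apply=> //; first by rewrite cAB submxMl.
    by rewrite -scalemxAr scalemx_sub // cAX submxMl.
  apply: (nilpotent_mod (N := b + b) nilA) => //; rewrite exprD -mulmxE.
  exact: submx_trans (submxMr _ one) two.
move=> s nsc; split; last first.
  by split=> //; apply: submx_trans (addsmxSl _ _).
set Bs := B + s *: X; set W := (A + (S + f)%MS *m Bs)%MS.
have subW u : (u <= S + f)%MS -> (u *m Bs <= W)%MS.
  by move=> uS; apply: submx_trans (addsmxSr _ _); apply: submxMr.
have SBs : (S *m B <= W)%MS.
  have -> : S *m B = S *m Bs - s *: (S *m X).
    by rewrite mulmxDr -scalemxAr addrK.
  rewrite addmx_sub ?subW ?addsmxSl // eqmx_opp scalemx_sub //.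
  exact: submx_trans SX (addsmxSl _ _).
have tW : (A + S *m B <= W)%MS by rewrite addsmx_sub addsmxSl.
have vW : (v <= W)%MS.
  have -> : v = (s + c)^-1 *: (f *m Bs - t - s *: (f *m Y *m A)).
    rewrite mulmxDr -scalemxAr defX mulmxDr !mulmxA fphi mul1mx deffB.
    rewrite [s *: (_ + _)]scalerDr addrACA -(addrA _ (- t)) -opprD addrK.
    rewrite -scalerDl [c + s]addrC scalerA mulVf ?scale1r //.
    by rewrite addr_eq0.
  rewrite scalemx_sub // addmx_sub ?addmx_sub ?subW ?addsmxSr // eqmx_opp.
    exact: submx_trans tW.
  by rewrite scalemx_sub // (submx_trans (submxMl _ _)) ?addsmxSl.
have SW : (S <= W)%MS.
  by apply: submx_trans Sgen _; rewrite !addsmx_sub addsmxSl vW.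
split.
- exact: submx_trans AS (addsmxSl _ _).
- rewrite addsmxMr addsmx_sub; apply/andP.
  split; apply/(submx_trans _ (addsmxSl _ _)); rewrite mulmxDr -scalemxAr.
    by rewrite addmx_sub // scalemx_sub // (submx_trans SX).
  by rewrite addmx_sub // scalemx_sub // (submx_trans (submxMl _ _)).
- exact: addsmxSr.
rewrite addsmx_sub; apply/andP; split.
  by apply: submx_trans SW _; rewrite addsmxS // addsmxSl.
by apply: submx_trans (addsmxSl _ _); apply: addsmxSr.
Qed.

(** The density principle, for a fixed [A]: the hypothesis on punctured lines
    is the only topology used, and it is what vanishing of polynomials
    provides over an infinite field. *)
Lemma cyclic_mod_dense (A : 'M[F]_n.+1) (h : 'M[F]_n.+1 -> Prop) :
    mxnilpotent A ->
    (forall B X s0, (forall s, s != s0 -> h (B + s *: X)) -> h B) ->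
    (forall B v, mxnilpotent B -> A *m B = B *m A ->
       row_full (A + v + B)%MS -> h B) ->
  forall B, mxnilpotent B -> A *m B = B *m A -> h B.
Proof.
move=> nilA hline hcyc.
suff main : forall k B S v q, (n.+1 - \rank S <= k)%N -> mxnilpotent B ->
    A *m B = B *m A -> cyclic_layer A B S v q -> h B.
  move=> B nilB cAB; apply: (main n.+1 B A 0 0%N) => //.
    exact: leq_subr.
  split; first by rewrite submx_refl cAB submxMl sub0mx -addsmxA addsmxSl.
  by rewrite mul0mx expr0 -[kermx _]mulmx1 mulmx_ker sub0mx.
have full B S v q : mxnilpotent B -> A *m B = B *m A ->
    cyclic_layer A B S v q -> row_full S -> h B.
  move=> nilB cAB [[_ _ _ Sgen] _] fullS; apply: (hcyc _ v) => //.
  rewrite -sub1mx in fullS; rewrite -sub1mx; apply: submx_trans fullS _.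
  apply: submx_trans Sgen _.
  by rewrite addsmxS // submxMl.
elim=> [|k IH] B S v q Sk nilB cAB layer.
  apply: full layer _ => //; rewrite /row_full eqn_leq rank_leq_col.
  by rewrite -subn_eq0 -leqn0.
have [fullS|nfull] := boolP (row_full S); first exact: full layer fullS.
have [X [S' [v' [q' [s0 [rkS NX LX]]]]]] :=
  layer_step nilA nilB cAB layer nfull.
apply: (hline B X s0) => s ns0; have [cs ns] := NX s.
apply: IH (LX s ns0) => //; rewrite -ltnS; apply: leq_trans Sk.
apply: ltn_sub2l => //; exact: leq_trans rkS (rank_leq_col _).
Qed.

End Deformation.

(** * The algebra generated by a commuting nilpotent pair *)

Section Algebra.
Variables (F : fieldType) (n : nat) (P : mxpair F n).
Hypothesis NP : N2 P.
Local Notation alg := (generated_algebra P).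

Lemma alg_fst : P.1 \in alg.
Proof. by apply: seqv_sub_adjoin; rewrite mem_head. Qed.

Lemma alg_snd : P.2 \in alg.
Proof. by apply: seqv_sub_adjoin; rewrite !inE eqxx orbT. Qed.

Lemma alg1 : 1 \in alg.
Proof. by rewrite memvE sub1_agenv. Qed.

Lemma algX a k : a \in alg -> a ^+ k \in alg.
Proof.
move=> aA; elim: k => [|k IH]; first by rewrite expr0 alg1.
by rewrite exprS memvM.
Qed.

Lemma alg_monomial i j : P.1 ^+ i * P.2 ^+ j \in alg.
Proof.
by apply: memvM; apply: algX; rewrite ?alg_fst ?alg_snd.
Qed.

Lemma common_nilpotency : exists N, P.1 ^+ N.+1 = 0 /\ P.2 ^+ N.+1 = 0.
Proof.
case: NP => -[k Ak] [l Bl] _; exists (k + l)%N.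
by split; [rewrite -addnS exprD Ak mul0r | rewrite -addSn exprD Bl mulr0].
Qed.

Lemma alg_polynomial a : a \in alg -> exists N (c : nat -> nat -> F),
  a = \sum_(i < N) \sum_(j < N) c i j *: (P.1 ^+ i * P.2 ^+ j).
Proof.
have [N [A0 B0]] := common_nilpotency; have [_ _ cAB] := NP.
pose M := (\sum_(p : 'I_N.+1 * 'I_N.+1) <[P.1 ^+ p.1 * P.2 ^+ p.2]>)%VS.
have mono i j : P.1 ^+ i * P.2 ^+ j \in M.
  have [Ni|iN] := ltnP N i.
    by rewrite -(subnK Ni) exprD A0 mulr0 mul0r mem0v.
  have [Nj|jN] := ltnP N j.
    by rewrite -(subnK Nj) exprD B0 !mulr0 mem0v.
  rewrite memvE.
  pose ij := (Ordinal (iN : i < N.+1)%N, Ordinal (jN : j < N.+1)%N).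
  exact: (sumv_sup ij).
have : (alg <= M)%VS.
  apply: agenv_sub_modl.
    by rewrite -memvE; have := mono 0 0; rewrite mulr1.
  rewrite span_cons span_seq1 !prodvDl prod1v !subv_add subvv /=.
  apply/andP; split; rewrite {1}/M big_distrr /=; apply/subv_sumP => p _.
    by rewrite prodv_line -memvE mulrA -exprS mono.
  rewrite prodv_line -memvE mulrA (commrX p.1 (esym cAB)) -mulrA -exprS.
  exact: mono.
move=> /subvP sAM /sAM/memv_sumP[u u_line ->].
have /fin_all_exists[k kE] p : exists k, u p = k *: (P.1 ^+ p.1 * P.2 ^+ p.2).
  by apply/vlineP/u_line.
exists N.+1, (fun i j => k (inord i, inord j)).
rewrite pair_bigA /=; apply: eq_bigr => -[i j] _ /=.
by rewrite !inord_val kE.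
Qed.

Lemma alg_comm a b : a \in alg -> b \in alg -> a * b = b * a.
Proof.
have [_ _ cAB] := NP.
have comm2 c x :
    GRing.comm x P.1 -> GRing.comm x P.2 -> c \in alg -> GRing.comm x c.
  move=> cx1 cx2 /alg_polynomial[N [k ->]].
  apply: commr_sum => i _; apply: commr_sum => j _.
  rewrite /GRing.comm -scalerAr -scalerAl; congr (_ *: _).
  by apply: commrM; apply: commrX.
move=> aA bA; apply: (comm2 b) => //; exact/commr_sym/(comm2 a).
Qed.

Lemma cyclic_vectorP v :
  cyclic_vector P v <-> forall u, exists2 a, a \in alg & u = a *m v.
Proof.
split=> [cv u|cv u].
  have [N [c ->]] := cv u.
  exists (\sum_(i < N) \sum_(j < N) c i j *: (P.1 ^+ i * P.2 ^+ j)).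
    rewrite rpred_sum // => i _; rewrite rpred_sum // => j _.
    by rewrite rpredZ ?alg_monomial.
  rewrite mulmx_suml; apply: eq_bigr => i _; rewrite mulmx_suml.
  by apply: eq_bigr => j _; rewrite -scalemxAl.
have [a /alg_polynomial[N [c ->]] ->] := cv u; exists N, c.
rewrite mulmx_suml; apply: eq_bigr => i _; rewrite mulmx_suml.
by apply: eq_bigr => j _; rewrite -scalemxAl.
Qed.

Lemma trmxX (A : 'M[F]_n.+1) k : (A ^+ k)^T = A^T ^+ k.
Proof.
elim: k => [|k IH]; first by rewrite !expr0 trmx1.
by rewrite exprS exprSr -mulmxE trmx_mul IH.
Qed.

Lemma trmx_monomial i j :
  P.1^T ^+ i *m P.2^T ^+ j = (P.1 ^+ i * P.2 ^+ j)^T.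
Proof.
have [_ _ cAB] := NP.
by rewrite (commXX i j cAB) -mulmxE trmx_mul !trmxX.
Qed.

Lemma cyclic_vector_trP w :
  cyclic_vector (trmx_pair P) w <->
  forall u : 'rV_n.+1, exists2 a, a \in alg & u = w^T *m a.
Proof.
split=> [cw u|cw u].
  have [N [c defu]] := cw u^T.
  exists (\sum_(i < N) \sum_(j < N) c i j *: (P.1 ^+ i * P.2 ^+ j)).
    rewrite rpred_sum // => i _; rewrite rpred_sum // => j _.
    by rewrite rpredZ ?alg_monomial.
  apply: trmx_inj; rewrite defu trmx_mul trmxK !linear_sum mulmx_suml.
  apply: eq_bigr => i _; rewrite linear_sum mulmx_suml.
  by apply: eq_bigr => j _; rewrite linearZ /= -scalemxAl -trmx_monomial.
have [a /alg_polynomial[N [c ->]] defu] := cw u^T; exists N, c.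
apply: trmx_inj; rewrite defu !linear_sum; apply: eq_bigr => i _.
rewrite !linear_sum; apply: eq_bigr => j _.
by rewrite !linearZ /= trmx_mul trmx_monomial trmxK.
Qed.

(** This turns out to be the maximal ideal, see [local_aug]. *)
Definition aug : {vspace 'M[F]_n.+1} := (alg * <<[:: P.1; P.2]>>)%VS.

Lemma alg_aug : alg = (1 + aug)%VS :> {vspace _}.
Proof.
rewrite /aug; apply/eqP; rewrite eqEsubv subv_add; apply/andP; split.
  apply: agenv_sub_modl; first exact: addvSl.
  set U := <<_>>%VS; have Ualg : (U <= alg)%VS.
    by apply: subv_trans (sub_agenv _); exact: addvSr.
  rewrite prodvDl prod1v subv_add subvv prodvDr prodv1 subv_add /=.
  apply/andP; split; apply: subv_trans (addvSr _ _).
    by rewrite -[X in (X <= _)%VS]prod1v prodvSl ?sub1_agenv.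
  by rewrite prodvA prodvSl // prodv_sub.
rewrite sub1_agenv prodv_sub //; apply: subv_trans (sub_agenv _); exact: addvSr.
Qed.

Lemma augP x :
  reflect (exists a b, [/\ a \in alg, b \in alg & x = a * P.1 + b * P.2])
          (x \in aug).
Proof.
rewrite /aug span_cons span_seq1 prodvDr; apply: (iffP memv_addP).
  by move=> [_ /memv_cosetP[a aA ->]] [_ /memv_cosetP[b bA ->] ->]; exists a, b.
move=> [a [b [aA bA ->]]]; exists (a * P.1); [|exists (b * P.2)] => //.
  by rewrite memv_mul ?memv_line.
by rewrite memv_mul ?memv_line.
Qed.

Lemma aug_sub_alg : (aug <= alg)%VS.
Proof. by rewrite alg_aug addvSr. Qed.

Lemma aug_ideal : is_ideal alg aug.
Proof. by split; [exact: aug_sub_alg | rewrite /aug prodvA prodv_id]. Qed.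

Lemma aug_nilpotent x : x \in aug -> exists k, x ^+ k = 0.
Proof.
case/augP=> a [b [aA bA ->]]; have [N [A0 B0]] := common_nilpotency.
exists (N.+1 + N.+1)%N; rewrite exprDn_comm; last first.
  by apply: alg_comm; rewrite memvM ?alg_fst ?alg_snd.
apply: big1 => i _.
have [Ni|iN] := leqP N.+1 i.
  rewrite (exprMn_comm i (alg_comm bA alg_snd)) -(subnK Ni) (exprD P.2) B0.
  by rewrite !mulr0 mul0rn.
have Ni : (N.+1 <= N.+1 + N.+1 - i)%N by rewrite -addnBA ?leq_addr // ltnW.
rewrite (exprMn_comm _ (alg_comm aA alg_fst)) -(subnK Ni) (exprD P.1) A0.
by rewrite !mulr0 mul0r mul0rn.
Qed.

Lemma one_notin_aug : 1 \notin aug.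
Proof.
apply/negP => /aug_nilpotent[k] /eqP.
by rewrite expr1n oner_eq0.
Qed.

(** [c + y] with [y] nilpotent is invertible in [alg]: it divides
    [c ^+ k - (- y) ^+ k = c ^+ k]. *)
Lemma ideal_with_unit I c y : is_ideal alg I -> c != 0 -> y \in aug ->
  c%:A + y \in I -> I = alg :> {vspace _}.
Proof.
move=> [IA AI] c0 yA xI; have /subvP AI' := AI.
have [k yk0] := aug_nilpotent yA.
have yal : - y \in alg by rewrite memvN (subvP aug_sub_alg).
have : (c%:A : 'M[F]_n.+1) ^+ k \in I.
  have -> : (c%:A : 'M[F]_n.+1) ^+ k = c%:A ^+ k - (- y) ^+ k.
    by rewrite exprNn yk0 mulr0 subr0.
  rewrite subrXX_comm; last first.
    by apply: alg_comm => //; rewrite memvZ ?alg1.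
  set s := \sum_(i < k) _; have sA : s \in alg.
    by rewrite memv_suml // => i _; rewrite memvM ?algX ?memvZ ?alg1.
  rewrite opprK (alg_comm (subvP IA _ xI) sA); exact: AI' (memv_mul sA xI).
rewrite exprZn expr1n => cI.
have oneI : 1 \in I.
  by rewrite -[1](scalerK (expf_neq0 k c0)) memvZ.
apply/eqP; rewrite eqEsubv IA; apply/subvP => a aA.
by rewrite -[a]mulr1 AI' // memv_mul.
Qed.

Lemma alg_decomp x : x \in alg -> exists c y, y \in aug /\ x = c%:A + y.
Proof.
rewrite [in X in X -> _]alg_aug => /memv_addP[_ /vlineP[c ->] [y yA ->]].
by exists c, y.
Qed.

Lemma proper_ideal_sub_aug I :
  is_ideal alg I -> I != alg :> {vspace _} -> (I <= aug)%VS.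
Proof.
move=> idI nI; have [IA _] := idI; apply/subvP => x xI.
have [c [y [yA defx]]] := alg_decomp (subvP IA _ xI).
have [c0|c0] := eqVneq c 0; first by rewrite defx c0 scale0r add0r.
by case/eqP: nI; apply: ideal_with_unit c0 yA _; rewrite -?defx.
Qed.

Lemma aug_neq_alg : aug != alg :> {vspace _}.
Proof. by apply: contraNneq one_notin_aug => ->; exact: alg1. Qed.

Lemma local_aug : is_local_with alg aug.
Proof.
have maxA : is_maximal_ideal alg aug.
  split; [exact: aug_ideal | exact: aug_neq_alg |] => J idJ AJ.
  have [->|nJ] := eqVneq J (alg : {vspace _}); first by right.
  by left; apply/eqP; rewrite eqEsubv AJ proper_ideal_sub_aug.
split=> // m [idm nm maxm].
have [//|E] := maxm _ aug_ideal (proper_ideal_sub_aug idm nm).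
by have := aug_neq_alg; rewrite E eqxx.
Qed.

Lemma gorenstein_aug : is_gorenstein alg <-> \dim (annihilator alg aug) = 1%N.
Proof.
split=> [[m [_ um] dm]|d1]; last by exists aug => //; exact: local_aug.
by have [maxA _] := local_aug; rewrite (um _ maxA).
Qed.

Lemma socleP x : x \in annihilator alg aug <->
  [/\ x \in alg, x * P.1 = 0 & x * P.2 = 0].
Proof.
split=> [/annihilatorP[xA x0]|[xA xA0 xB0]].
  split=> //; apply: x0; apply/augP.
    by exists 1, 0; rewrite alg1 mem0v mul1r mul0r addr0.
  by exists 0, 1; rewrite alg1 mem0v mul1r mul0r add0r.
apply/annihilatorP; split=> // y /augP[a [b [aA bA ->]]].
rewrite mulrDr !mulrA !(alg_comm (a := x)) // -!mulrA xA0 xB0.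
by rewrite !mulr0 addr0.
Qed.

(** * Cyclic vectors and the Gorenstein property *)

Lemma last_nonzero_power (x a : 'M[F]_n.+1) N : x != 0 -> a ^+ N = 0 ->
  exists k, x * a ^+ k != 0 /\ x * a ^+ k * a = 0.
Proof.
move=> x0 aN; have exk : exists k, x * a ^+ k == 0.
  by exists N; rewrite aN mulr0.
case: (ex_minnP exk) => [[|k]] xk mink; first by rewrite mulr1 (negPf x0) in xk.
exists k; rewrite -mulrA -exprSr (eqP xk); split=> //.
by apply/negP => /mink; rewrite ltnn.
Qed.

(** Multiply [a] by the highest power of the first matrix, then of the second,
    that does not annihilate it. *)
Lemma socle_essential a : a \in alg -> a != 0 ->
  exists2 b, b \in alg & a * b \in annihilator alg aug /\ a * b != 0.
Proof.
move=> aA a0; have [N [A0 B0]] := common_nilpotency; have [_ _ cAB] := NP.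
have [k [ak0 akA]] := last_nonzero_power a0 A0.
have [l [akl0 aklB]] := last_nonzero_power ak0 B0.
exists (P.1 ^+ k * P.2 ^+ l); first exact: alg_monomial.
rewrite mulrA akl0; split=> //; apply/socleP; split=> //.
  by rewrite -mulrA memvM ?alg_monomial.
by rewrite -mulrA -(commrX l cAB) mulrA akA mul0r.
Qed.

Lemma mulmx_col_eq0 (a : 'M[F]_n.+1) :
  (forall u : 'cV_n.+1, a *m u = 0) -> a = 0.
Proof.
move=> a0; apply/matrixP => i j.
by have /matrixP/(_ i 0) := a0 (delta_mx j 0); rewrite -colE !mxE.
Qed.

Lemma dim_injective_image (vT : vectType F) (f : 'Hom('M[F]_n.+1, vT)) :
  (forall a, a \in alg -> f a = 0 -> a = 0) -> \dim (f @: alg) = \dim alg.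
Proof.
move=> f_inj; apply/limg_dim_eq/eqP; rewrite -subv0; apply/subvP => a.
by rewrite memv_cap memv_ker memv0 => /andP[/f_inj fa /eqP/fa->].
Qed.

Lemma injective_surjective_on_alg (vT : vectType F) (f : 'Hom('M[F]_n.+1, vT)) :
  \dim alg = \dim {:vT} -> (forall a, a \in alg -> f a = 0 -> a = 0) ->
  forall u, exists2 a, a \in alg & u = f a.
Proof.
move=> dA f_inj u; apply/memv_imgP.
suff -> : (f @: alg)%VS = fullv by rewrite memvf.
by apply/eqP; rewrite eqEdim subvf -dA (dim_injective_image f_inj) leqnn.
Qed.

Lemma dim_col : \dim {:'cV[F]_n.+1} = n.+1.
Proof. by rewrite dimvf /dim /= muln1. Qed.

Lemma dim_row : \dim {:'rV[F]_n.+1} = n.+1.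
Proof. by rewrite dimvf /dim /= mul1n. Qed.

Lemma cyclic_of_faithful v : \dim alg = n.+1 ->
  (forall a, a \in alg -> a *m v = 0 -> a = 0) -> cyclic_vector P v.
Proof.
move=> dA v_inj; apply/cyclic_vectorP => u.
have f_inj a : a \in alg -> linfun (mulmxr v) a = 0 -> a = 0.
  by move=> aA; rewrite lfunE /=; apply: v_inj.
have dE := etrans dA (esym dim_col).
have [a aA ->] := injective_surjective_on_alg dE f_inj u.
by exists a; rewrite ?lfunE.
Qed.

Lemma cyclic_tr_of_faithful w : \dim alg = n.+1 ->
  (forall a, a \in alg -> w^T *m a = 0 -> a = 0) ->
  cyclic_vector (trmx_pair P) w.
Proof.
move=> dA w_inj; apply/cyclic_vector_trP => u.
have f_inj a : a \in alg -> linfun (mulmx w^T) a = 0 -> a = 0.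
  by move=> aA; rewrite lfunE /=; apply: w_inj.
have dE := etrans dA (esym dim_row).
have [a aA ->] := injective_surjective_on_alg dE f_inj u.
by exists a; rewrite ?lfunE.
Qed.

(** An element killing [v] kills [b v] for every [b] of the commutative algebra,
    hence the whole space. *)
Lemma cyclic_faithful v : cyclic_vector P v ->
  forall a, a \in alg -> a *m v = 0 -> a = 0.
Proof.
move=> /cyclic_vectorP cv a aA av; apply: mulmx_col_eq0 => u.
have [b bA ->] := cv u.
by rewrite mulmxA [a *m b](alg_comm aA bA) -mulmxE -mulmxA av mulmx0.
Qed.

Lemma dim_alg_cyclic v : cyclic_vector P v -> \dim alg = n.+1.
Proof.
move=> cv; rewrite -(@dim_injective_image _ (linfun (mulmxr v))); last first.
  by move=> a aA; rewrite lfunE /=; apply: cyclic_faithful.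
apply: etrans dim_col; congr (\dim _); apply/eqP; rewrite eqEsubv subvf /=.
apply/subvP => u _; have /cyclic_vectorP/(_ u)[a aA ->] := cv.
by apply/memv_imgP; exists a; rewrite ?lfunE.
Qed.

(** On the socle, [w^T b a v] depends on [b] only through its constant term;
    since the rows [w^T b] fill the space, [w^T a v = 0] forces [a v = 0].  The
    scalar [w^T a v] therefore determines the socle element [a]. *)
Lemma gorenstein_cyclic v w :
  cyclic_vector P v -> cyclic_vector (trmx_pair P) w -> is_gorenstein alg.
Proof.
move=> cv /cyclic_vector_trP cw; apply/gorenstein_aug.
set soc := annihilator _ _; apply/eqP; rewrite eqn_leq; apply/andP; split.
  pose f : 'Hom('M[F]_n.+1, 'M[F]_1) := linfun (mulmxr v \o mulmx w^T).
  rewrite -(@limg_dim_eq _ _ _ f soc); last first.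
    apply/eqP; rewrite -subv0; apply/subvP => a.
    rewrite memv_cap memv_ker lfunE /= memv0 => /andP[/socleP[aA aA0 aB0] /eqP wav].
    apply/eqP/(cyclic_faithful cv) => //.
    have uav (u : 'rV_n.+1) : u *m (a *m v) = 0.
      have [b /alg_decomp[c [y [/augP[b1 [b2 [b1A b2A ->]]] ->]]] ->] := cw u.
      rewrite mulmxA -[w^T *m _ *m a]mulmxA mulmxE !mulrDl -!mulrA.
      rewrite -[P.1 * a](alg_comm aA alg_fst).
      rewrite -[P.2 * a](alg_comm aA alg_snd).
      rewrite aA0 aB0 !mulr0 !addr0 -scalerAl mul1r -scalemxAr -scalemxAl.
      by rewrite wav scaler0.
    apply/matrixP=> i j.
    by have /matrixP/(_ 0 j) := uav (delta_mx 0 i); rewrite -rowE !mxE.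
  by rewrite (leq_trans (dimvS (subvf _))) // dimvf.
rewrite lt0n dimv_eq0; apply/negP => /eqP soc0.
have [b _ []] := socle_essential alg1 (oner_neq0 _).
by rewrite -/soc soc0 memv0 => ->.
Qed.

Lemma gorenstein_socle_mul : is_gorenstein alg ->
  exists2 z, z != 0 & forall a, a \in alg -> a != 0 ->
    exists2 b, b \in alg & a * b = z.
Proof.
move=> /gorenstein_aug d1; set soc := annihilator _ _ in d1.
have [z zsoc z0] : exists2 z, z \in soc & z != 0.
  exists (vpick soc); first exact: memv_pick.
  by rewrite vpick0 -dimv_eq0 d1.
have socz : (soc <= <[z]>)%VS.
  have : <[z]>%VS == soc by rewrite eqEdim -memvE zsoc dim_vline z0 d1.
  by move/eqP->.
exists z => // a aA a0; have [b bA [absoc ab0]] := socle_essential aA a0.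
have /vlineP[c abE] := subvP socz _ absoc.
have c0 : c != 0 by apply: contraNneq ab0 => c0; rewrite abE c0 scale0r.
by exists (c^-1 *: b); rewrite ?memvZ // -scalerAr abE scalerK.
Qed.

End Algebra.

Lemma piU_iff (F : fieldType) (n : nat) (P : mxpair F n) :
  piU P <-> [/\ N2 P, is_gorenstein (generated_algebra P)
              & \dim (generated_algebra P) = n.+1].
Proof.
split=> [[[[Q v] w] [NQ cv cw] /= <-]|[NP gor dA]].
  rewrite /proj_N2 /=; split=> //; first exact: gorenstein_cyclic cv cw.
  exact: dim_alg_cyclic cv.
have [z z0 zmul] := gorenstein_socle_mul NP gor.
have [i [j zij]] := matrix0Pn _ z0.
(* The entry (i, j) of the socle generator z is nonzero, so z moves the j-th
   column basis vector and its transpose moves the i-th one. *)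
exists (P, delta_mx j 0, (delta_mx 0 i)^T) => //; split=> //.
  apply: cyclic_of_faithful => // a aA av; apply/eqP/negPn/negP => a0.
  have [b bA abz] := zmul a aA a0; case/eqP: zij.
  have: z *m delta_mx j 0 = 0 :> 'cV_n.+1.
    by rewrite -abz (alg_comm NP aA bA) // -mulmxE -mulmxA av mulmx0.
  by rewrite -colE => /matrixP/(_ i 0); rewrite !mxE.
apply: cyclic_tr_of_faithful => // a aA; rewrite trmxK => wa.
apply/eqP/negPn/negP => a0.
have [b bA abz] := zmul a aA a0; case/eqP: zij.
have: delta_mx 0 i *m z = 0 :> 'rV_n.+1.
  by rewrite -abz -mulmxE mulmxA wa mul0mx.
by rewrite -rowE => /matrixP/(_ 0 j); rewrite !mxE.
Qed.

(** * Polynomial conditions along lines *)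

Section Lines.
Variable F : closedFieldType.

Lemma horner_eq0_off_point (q : {poly F}) s0 :
  (forall s, s != s0 -> q.[s] = 0) -> forall s, q.[s] = 0.
Proof.
move=> q0; suff -> : q = 0 by move=> s; rewrite horner0.
have: q * ('X - s0%:P) == 0.
  apply/negPn/negP => /closed_nonrootP[s]; rewrite rootM root_XsubC.
  by apply/negP/negPn; case: eqVneq => [//|/q0/eqP]; rewrite ?orbT // orbF.
by rewrite mulf_eq0 polyXsubC_eq0 orbF => /eqP.
Qed.

Lemma meval_line m (p : {mpoly F[m]}) (x y : 'I_m -> F) :
  exists q : {poly F}, forall s, p.@[fun i => x i + s * y i] = q.[s].
Proof.
exists (\sum_(k <- msupp p)
          (p@_k)%:P * \prod_i ((x i)%:P + 'X * (y i)%:P) ^+ k i) => s.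
rewrite mevalE horner_sum; apply: eq_bigr => k _.
rewrite hornerM hornerC horner_prod; congr (_ * _); apply: eq_bigr => i _.
by rewrite horner_exp !hornerE.
Qed.

Lemma det_line m (M N : 'M[F]_m) :
  exists q : {poly F}, forall s, \det (M + s *: N) = q.[s].
Proof.
exists (\det (map_mx polyC M + 'X *: map_mx polyC N)) => s.
rewrite -horner_evalE -det_map_mx; congr (\det _); apply/matrixP => i j.
by rewrite !mxE /= /horner_eval !hornerE.
Qed.

End Lines.

(** * Density *)

Section Density.
Variables (F : closedFieldType) (n : nat).
Implicit Types (P : mxpair F n).

Lemma N2_trmx P : N2 P -> N2 (trmx_pair P).
Proof.
case=> -[k Ak] [l Bl] cAB; split; last by rewrite /= -!trmx_mul cAB.
  by exists k; rewrite -trmxX Ak trmx0.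
by exists l; rewrite -trmxX Bl trmx0.
Qed.

(** Nakayama's lemma for the nilpotent ideal generated by the two matrices:
    substitute [w = c v + x A + y B] into itself, first in [x], then in [y]. *)
Lemma cyclic_of_generating_mod P (v : 'rV[F]_n.+1) :
  N2 P -> row_full (P.1 + v + P.2)%MS -> cyclic_vector (trmx_pair P) v^T.
Proof.
move=> NP full; apply/(cyclic_vector_trP NP) => u; rewrite trmxK.
have [N [A0 B0]] := common_nilpotency NP.
have alg_pow := @algX F n P; have [A1 A2] := (alg_fst P, alg_snd P).
have [_ _ cAB] := NP.
have base w : exists c (x y : 'rV_n.+1), w = c *: v + x *m P.1 + y *m P.2.
  have /sub_addsmxP[[t y] /= ->] := submx_full w full.
  have /sub_addsmxP[[x c] /= ->] := submxMl t (P.1 + v)%MS.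
  exists (c 0 0), x, y; rewrite [x *m _ + _]addrC.
  by rewrite {1}[c]mx11_scalar mul_scalar_mx.
have modA k w : exists a (x y : 'rV_n.+1),
    a \in generated_algebra P /\ w = v *m a + x *m P.1 ^+ k + y *m P.2.
  elim: k => [|k [a [x [y [aA ->]]]]].
    by exists 0, w, 0; rewrite mem0v mulmx0 mul0mx add0r addr0 mulmx1.
  have [c [x' [y' ->]]] := base x.
  exists (a + c *: P.1 ^+ k), x', (y' *m P.1 ^+ k + y).
  split; first by rewrite memvD ?memvZ ?alg_pow.
  rewrite !mulmxDl !mulmxDr -!scalemxAl -!scalemxAr -!addrA.
  congr (_ + (_ + _)); rewrite -mulmxA mulmx_exprS; congr (_ + _).
  by rewrite -!mulmxA [P.2 *m _](commrX k (esym cAB)).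
have modB k w : exists a (y : 'rV_n.+1),
    a \in generated_algebra P /\ w = v *m a + y *m P.2 ^+ k.
  elim: k => [|k [a [y [aA ->]]]].
    by exists 0, w; rewrite mem0v mulmx0 add0r mulmx1.
  have [b [x [y' [bA ->]]]] := modA N.+1 y.
  exists (a + b * P.2 ^+ k), y'; split; first by rewrite memvD ?memvM ?alg_pow.
  by rewrite A0 mulmx0 addr0 mulmxDl mulmxDr addrA -!mulmxA mulmx_exprS.
have [a [y [aA ->]]] := modB N.+1 u.
by exists a; rewrite // B0 mulmx0 addr0.
Qed.

Lemma row_full_addsmx3 m (A : 'M[F]_m) (v : 'rV_m) (B : 'M_m) :
  row_full (A + v + B)%MS = row_full (col_mx (col_mx A v) B).
Proof.
rewrite /row_full -(addsmxE (col_mx A v) B).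
by rewrite (adds_eqmx (addsmxE A v) (eqmx_refl B)).
Qed.

Lemma pair_line (p : {mpoly F[n.+1 * n.+1 + n.+1 * n.+1]})
    (A B X : 'M[F]_n.+1) :
  exists q : {poly F}, forall s, p.@[mxpair_coord (A, B + s *: X)] = q.[s].
Proof.
have [q qE] := meval_line p (mxpair_coord (A, B)) (mxpair_coord (0, X)).
exists q => s; rewrite -qE !mevalE; apply: eq_bigr => k _; congr (_ * _).
apply: eq_bigr => i _; congr (_ ^+ _); rewrite /mxpair_coord /=.
rewrite linear0 linearD linearZ /= !mxE.
by case: split => j; rewrite !mxE ?mulr0 ?addr0.
Qed.

(** The density principle is applied twice.  For [A], it reduces the claim to
    [B] with a cyclic row vector [v].  Some maximal minor [D B] of the stacked
    matrix of [A], [v] and [B] is then nonzero, and the principle for [A^T],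
    applied to the vanishing of [p D], reaches pairs for which the transposes
    also have a cyclic vector while [v] remains cyclic wherever [D] is
    nonzero. *)
Lemma vanish_on_N2 (p : {mpoly F[n.+1 * n.+1 + n.+1 * n.+1]}) :
    (forall P, piU P -> p.@[mxpair_coord P] = 0) ->
  forall P, N2 P -> p.@[mxpair_coord P] = 0.
Proof.
move=> p0 [A B] [/= nilA nilB cAB].
pose vanish C := p.@[mxpair_coord (A, C)] = 0.
apply: (@cyclic_mod_dense F n A vanish nilA) => //; rewrite {}/vanish.
  move=> {nilB cAB}B X s0 h; have [q qE] := pair_line p A B X.
  rewrite -[B]addr0 -(scale0r X) qE.
  by apply: (@horner_eq0_off_point _ _ s0) => s ns; rewrite -qE h.
move=> {nilB cAB}B v nilB cAB fullB.
have fullC := fullB; rewrite row_full_addsmx3 in fullC.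
pose g := fullrankfun fullC.
pose D C := \det (rowsub g (col_mx (col_mx A v) C)).
have D0 : D B != 0 by have := fullrowsub_unit fullC; rewrite unitmxE unitfE.
suff: p.@[mxpair_coord (A, B)] * D B = 0.
  by move/eqP; rewrite mulf_eq0 (negPf D0) orbF => /eqP.
rewrite -[B]trmxK.
have [nilAt nilBt cABt] : N2 (trmx_pair (A, B)) by apply: N2_trmx.
pose vanish C := p.@[mxpair_coord (A, C^T)] * D C^T = 0.
apply: (@cyclic_mod_dense F n A^T vanish nilAt) => //; rewrite {}/vanish.
  move=> {nilBt cABt}C X s0 h; have [q qE] := pair_line p A C^T X^T.
  have [r rE] := det_line (rowsub g (col_mx (col_mx A v) C^T))
                          (rowsub g (col_mx 0 X^T)).
  have hE s :
      p.@[mxpair_coord (A, (C + s *: X)^T)] * D (C + s *: X)^T = (q * r).[s].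
    rewrite hornerM -qE -rE linearD linearZ /=; congr (_ * \det _).
    apply/matrixP => i j; rewrite !mxE.
    by case: (split (g i)) => k; rewrite !mxE ?mulr0 ?addr0.
  have := hE 0; rewrite scale0r addr0 => ->.
  by apply: (@horner_eq0_off_point _ _ s0) => s ns; rewrite -hE h.
move=> C w nilC cAC fullCw.
have [->|DC0] := eqVneq (D C^T) 0; first by rewrite mulr0.
have NP : N2 (A^T, C) by split.
have NPt : N2 (A, C^T) by have := N2_trmx NP; rewrite /trmx_pair /= trmxK.
rewrite p0 ?mul0r //; exists ((A, C^T), w^T, v^T) => //; split=> //.
  by have := cyclic_of_generating_mod NP fullCw; rewrite /trmx_pair /= trmxK.
apply: cyclic_of_generating_mod => //=; rewrite row_full_addsmx3.
have: row_full (rowsub g (col_mx (col_mx A v) C^T)).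
  by rewrite row_full_unit unitmxE unitfE.
rewrite -!sub1mx => h; apply: submx_trans h _; exact: rowsub_sub.
Qed.

End Density.

Theorem corollary2p4 (F : closedFieldType) (n : nat) :
  (forall P : mxpair F n,
     piU P <-> [/\ N2 P, is_gorenstein (generated_algebra P)
                 & \dim (generated_algebra P) = n.+1])
  /\ zariski_dense_in (@N2 F n) (@piU F n).
Proof.
split=> [P|]; first exact: piU_iff.
split=> [P /piU_iff[] //|P NP Z [T ZT] piUZ].
apply/ZT => p Tp; apply: vanish_on_N2 NP => Q /piUZ /ZT; exact.
Qed.
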